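(* Let $F$ be a field of characteristic $0$ and let $(D,\prec,\succ)$ be a dendriform dialgebra over $F$. Then $D$ can be embedded into its universal enveloping Rota-Baxter algebra $U(D)$ of weight $0$, i.e. the canonical linear map $D\to U(D)$ (sending each basis element $x_i\in X$ to the class of the generator $x_i$) is injective. In other words, $D$ is isomorphic to a dendriform subdialgebra of a Rota-Baxter algebra of weight $0$.
   Context: Associative algebras are not required to have a unit. A dendriform dialgebra over $F$ is an $F$-vector space $D$ with two ($F$-bilinear) binary operations $\prec,\succ$ such that for all $x,y,z\in D$: $(x\prec y)\prec z=x\prec(y\prec z+y\succ z)$, $(x\succ y)\prec z=x\succ(y\prec z)$, $(x\prec y+x\succ y)\succ z=x\succ(y\succ z)$. A Rota-Baxter algebra of weight $0$ over $F$ is an associative $F$-algebra $A$ with an $F$-linear operator $P:A\to A$ such that $P(x)P(y)=P(P(x)y)+P(xP(y))$ for all $x,y\in A$. Such an $A$ is regarded as a dendriform dialgebra via $x\prec y=xP(y)$, $x\succ y=P(x)y$. Let $RB(X)$ denote the free (non-unital) Rota-Baxter algebra of weight $0$ over $F$ generated by a set $X$. For a subset $R\subseteq RB(X)$, $RB(X|R)=RB(X)/Id(R)$, where $Id(R)$ is the Rota-Baxter ideal (two-sided ideal closed under $P$) generated by $R$. Let $X=\{x_i\mid i\in I\}$ be a linear basis of $D$, and let $\{x_i\prec x_j\}$, $\{x_i\succ x_j\}$ denote the linear combinations of elements of $X$ that express the products $x_i\prec x_j$, $x_i\succ x_j$ in $D$. The universal enveloping Rota-Baxter algebra of weight $0$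 of $D$ is $$U(D)=RB\big(X\,\big|\,x_iP(x_j)=\{x_i\prec x_j\},\ P(x_i)x_j=\{x_i\succ x_j\},\ x_i,x_j\in X\big).$$ *)

(* Defs.v *)
From HB Require Import structures.
From mathcomp Require Import all_boot all_order all_algebra.
From mathcomp Require Import boolp classical_sets.

Set Implicit Arguments.
Unset Strict Implicit.
Unset Printing Implicit Defensive.

Import GRing.Theory.

Local Open Scope classical_set_scope.
Local Open Scope ring_scope.
Local Open Scope quotient_scope.

HB.mixin Record isDendriform (F : fieldType) D of GRing.Lmodule F D := {
  dprec : D -> D -> D;
  dsucc : D -> D -> D;
  dprec_linearl : forall y, linear (dprec^~ y);
  dprec_linearr : forall x, linear (dprec x);
  dsucc_linearl : forall y, linear (dsucc^~ y);
  dsucc_linearr : forall x, linear (dsucc x);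
  dprecA : forall x y z,
    dprec (dprec x y) z = dprec x (dprec y z + dsucc y z);
  dsucc_precA : forall x y z, dprec (dsucc x y) z = dsucc x (dprec y z);
  dsuccA : forall x y z,
    dsucc (dprec x y + dsucc x y) z = dsucc x (dsucc y z)
}.

#[short(type="dendriformType")]
HB.structure Definition Dendriform (F : fieldType) :=
  {D of GRing.Lmodule F D & isDendriform F D}.

Notation "x ≺ y" := (dprec x y) (at level 40, no associativity) : ring_scope.
Notation "x ≻ y" := (dsucc x y) (at level 40, no associativity) : ring_scope.

Definition dendriform_morphism (F : fieldType) (D E : dendriformType F)
    (f : D -> E) : Prop :=
  [/\ linear f,
      {morph f : x y / x ≺ y >-> x ≺ y} &
      {morph f : x y / x ≻ y >-> x ≻ y}].

HB.mixin Record isNonUnitalAlgebra (F : fieldType) A of GRing.Lmodule F A := {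
  numul : A -> A -> A;
  numul_linearl : forall y, linear (numul^~ y);
  numul_linearr : forall x, linear (numul x);
  numulA : associative numul
}.

#[short(type="nonUnitalAlgType")]
HB.structure Definition NonUnitalAlgebra (F : fieldType) :=
  {A of GRing.Lmodule F A & isNonUnitalAlgebra F A}.

Notation "x ⋆ y" := (numul x y) (at level 40, left associativity) : ring_scope.

HB.mixin Record isRotaBaxter (F : fieldType) A of NonUnitalAlgebra F A := {
  rbP : A -> A;
  rbP_linear : linear rbP;
  rbPM : forall x y : A, rbP x ⋆ rbP y = rbP (rbP x ⋆ y) + rbP (x ⋆ rbP y)
}.

#[short(type="rotaBaxterType")]
HB.structure Definition RotaBaxter (F : fieldType) :=
  {A of NonUnitalAlgebra F A & isRotaBaxter F A}.

HB.instance Definition _ (F : fieldType) (A : rotaBaxterType F) :=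
  GRing.isLinear.Build F A A *:%R (@rbP F A) (@rbP_linear F A).

Definition rb_morphism (F : fieldType) (A B : rotaBaxterType F)
    (f : A -> B) : Prop :=
  [/\ linear f,
      {morph f : x y / x ⋆ y >-> x ⋆ y} &
      {morph f : x / rbP x >-> rbP x}].

Section NonUnitalTheory.
Variables (F : fieldType) (A : nonUnitalAlgType F).
Implicit Types (x y z : A) (a : F).

Lemma numulDl x y z : (x + y) ⋆ z = x ⋆ z + y ⋆ z.
Proof. by have := numul_linearl z 1 x y; rewrite !scale1r. Qed.

Lemma numulDr x y z : x ⋆ (y + z) = x ⋆ y + x ⋆ z.
Proof. by have := numul_linearr x 1 y z; rewrite !scale1r. Qed.

Lemma numul0r x : 0 ⋆ x = 0.
Proof. by apply: (@addrI _ (0 ⋆ x)); rewrite -numulDl !addr0. Qed.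

Lemma numulr0 x : x ⋆ 0 = 0.
Proof. by apply: (@addrI _ (x ⋆ 0)); rewrite -numulDr !addr0. Qed.

Lemma numulZl a x y : (a *: x) ⋆ y = a *: (x ⋆ y).
Proof. by have := numul_linearl y a x 0; rewrite numul0r !addr0. Qed.

Lemma numulZr a x y : x ⋆ (a *: y) = a *: (x ⋆ y).
Proof. by have := numul_linearr x a y 0; rewrite numulr0 !addr0. Qed.

Lemma numulNl x y : (- x) ⋆ y = - (x ⋆ y).
Proof. by rewrite -scaleN1r numulZl scaleN1r. Qed.

Lemma numulNr x y : x ⋆ (- y) = - (x ⋆ y).
Proof. by rewrite -scaleN1r numulZr scaleN1r. Qed.

Lemma numulBl x y z : (x - y) ⋆ z = x ⋆ z - y ⋆ z.
Proof. by rewrite numulDl numulNl. Qed.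

Lemma numulBr x y z : x ⋆ (y - z) = x ⋆ y - x ⋆ z.
Proof. by rewrite numulDr numulNr. Qed.

End NonUnitalTheory.

(* An alias: the dendriform operations x ≺ y = x P(y), x ≻ y = P(x) y are
   attached to rb_dendriform A and not to A itself, so that they cannot clash
   with another dendriform structure on the carrier. *)
Definition rb_dendriform (F : fieldType) (A : rotaBaxterType F) : Type := A.

Section RBDendriform.
Variables (F : fieldType) (A : rotaBaxterType F).
Implicit Types x y z : A.

Let prec x y := x ⋆ rbP y.
Let succ x y := rbP x ⋆ y.

Fact rb_prec_linearl y : linear (prec^~ y).
Proof. exact: numul_linearl. Qed.

Fact rb_prec_linearr x : linear (prec x).
Proof. by move=> a u v; rewrite /prec linearP numul_linearr. Qed.

Fact rb_succ_linearl y : linear (succ^~ y).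
Proof. by move=> a u v; rewrite /succ linearP numul_linearl. Qed.

Fact rb_succ_linearr x : linear (succ x).
Proof. exact: numul_linearr. Qed.

Fact rb_precA x y z : prec (prec x y) z = prec x (prec y z + succ y z).
Proof. by rewrite /prec /succ -numulA rbPM linearD addrC. Qed.

Fact rb_succ_precA x y z : prec (succ x y) z = succ x (prec y z).
Proof. by rewrite /prec /succ numulA. Qed.

Fact rb_succA x y z : succ (prec x y + succ x y) z = succ x (succ y z).
Proof. by rewrite /prec /succ numulA rbPM linearD addrC. Qed.

HB.instance Definition _ := GRing.Lmodule.on (rb_dendriform A).
HB.instance Definition _ := isDendriform.Build F (rb_dendriform A)
  rb_prec_linearl rb_prec_linearr rb_succ_linearl rb_succ_linearr
  rb_precA rb_succ_precA rb_succA.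

End RBDendriform.

(* Formal Rota-Baxter expressions over X, to be identified modulo the
   identities that hold in every Rota-Baxter algebra of weight 0. There is no
   term for a unit; the opposite of t is RBscale (- 1) t. *)
Inductive rbterm (F : fieldType) (X : Type) : Type :=
| RBgen of X
| RBzero
| RBadd of rbterm F X & rbterm F X
| RBscale of F & rbterm F X
| RBmul of rbterm F X & rbterm F X
| RBop of rbterm F X.

Arguments RBgen {F X}.
Arguments RBzero {F X}.
Arguments RBadd {F X}.
Arguments RBscale {F X}.
Arguments RBmul {F X}.
Arguments RBop {F X}.

Inductive rbeq (F : fieldType) (X : Type) : rbterm F X -> rbterm F X -> Prop :=
| rbeq_refl t : rbeq t t
| rbeq_sym t u : rbeq t u -> rbeq u t
| rbeq_trans t u v : rbeq t u -> rbeq u v -> rbeq t v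
| rbeq_add t t' u u' : rbeq t t' -> rbeq u u' -> rbeq (RBadd t u) (RBadd t' u')
| rbeq_scale a t t' : rbeq t t' -> rbeq (RBscale a t) (RBscale a t')
| rbeq_mul t t' u u' : rbeq t t' -> rbeq u u' -> rbeq (RBmul t u) (RBmul t' u')
| rbeq_op t t' : rbeq t t' -> rbeq (RBop t) (RBop t')
| rbeq_addA t u v : rbeq (RBadd t (RBadd u v)) (RBadd (RBadd t u) v)
| rbeq_addC t u : rbeq (RBadd t u) (RBadd u t)
| rbeq_add0 t : rbeq (RBadd RBzero t) t
| rbeq_addN t : rbeq (RBadd (RBscale (- 1) t) t) RBzero
| rbeq_scaleA a b t : rbeq (RBscale a (RBscale b t)) (RBscale (a * b) t)
| rbeq_scale1 t : rbeq (RBscale 1 t) t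
| rbeq_scaleDr a t u :
    rbeq (RBscale a (RBadd t u)) (RBadd (RBscale a t) (RBscale a u))
| rbeq_scaleDl a b t :
    rbeq (RBscale (a + b) t) (RBadd (RBscale a t) (RBscale b t))
| rbeq_mulDl t u v : rbeq (RBmul (RBadd t u) v) (RBadd (RBmul t v) (RBmul u v))
| rbeq_mulDr t u v : rbeq (RBmul t (RBadd u v)) (RBadd (RBmul t u) (RBmul t v))
| rbeq_mulZl a t u : rbeq (RBmul (RBscale a t) u) (RBscale a (RBmul t u))
| rbeq_mulZr a t u : rbeq (RBmul t (RBscale a u)) (RBscale a (RBmul t u))
| rbeq_mulA t u v : rbeq (RBmul t (RBmul u v)) (RBmul (RBmul t u) v)
| rbeq_opD t u : rbeq (RBop (RBadd t u)) (RBadd (RBop t) (RBop u))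
| rbeq_opZ a t : rbeq (RBop (RBscale a t)) (RBscale a (RBop t))
| rbeq_opM t u :
    rbeq (RBmul (RBop t) (RBop u))
         (RBadd (RBop (RBmul (RBop t) u)) (RBop (RBmul t (RBop u)))).

HB.instance Definition _ (F : fieldType) (X : Type) :=
  gen_eqMixin (rbterm F X).
HB.instance Definition _ (F : fieldType) (X : Type) :=
  gen_choiceMixin (rbterm F X).

Section FreeRB.
Variables (F : fieldType) (X : Type).
Local Notation T := (rbterm F X).
Implicit Types (t u : T).

Definition rbeqb : rel T := fun t u => `[< rbeq t u >].

Fact rbeqb_equiv : equiv_class_of rbeqb.
Proof.
split=> [t|t u|u t v]; first exact/asboolP/rbeq_refl.
  by apply/asboolP/asboolP; apply: rbeq_sym.
by move=> /asboolP tu /asboolP uv; apply/asboolP/(rbeq_trans tu uv).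
Qed.

Canonical rbeqb_equiv_rel := EquivRelPack rbeqb_equiv.
Canonical rbeqb_encModRel := defaultEncModRel rbeqb.

Definition freeRB : Type := {eq_quot rbeqb}.

HB.instance Definition _ : EqQuotient T rbeqb freeRB := EqQuotient.on freeRB.
HB.instance Definition _ := Choice.on freeRB.

Definition rbpi (t : T) : freeRB := \pi_freeRB t.

Definition freeRB_gen (i : X) : freeRB := rbpi (RBgen i).

Lemma rbpiP t u : rbeq t u <-> rbpi t = rbpi u.
Proof. by split=> [tu|/eqmodP/asboolP//]; apply/eqmodP/asboolP. Qed.

Lemma rbpiW t u : rbeq t u -> rbpi t = rbpi u.
Proof. by move/rbpiP. Qed.

Lemma rbpi_ind (Q : freeRB -> Prop) : (forall t, Q (rbpi t)) -> forall x, Q x.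
Proof. by move=> Qpi x; rewrite -[x]reprK; apply: Qpi. Qed.

Lemma repr_rbpi t : rbeq (repr (rbpi t)) t.
Proof. by apply/rbpiP; rewrite {1}/rbpi reprK. Qed.

Definition freeRB_add (x y : freeRB) := rbpi (RBadd (repr x) (repr y)).
Definition freeRB_opp (x : freeRB) := rbpi (RBscale (- 1) (repr x)).
Definition freeRB_scale (a : F) (x : freeRB) := rbpi (RBscale a (repr x)).
Definition freeRB_mul (x y : freeRB) := rbpi (RBmul (repr x) (repr y)).
Definition freeRB_op (x : freeRB) := rbpi (RBop (repr x)).

Lemma rbpi_add t u : freeRB_add (rbpi t) (rbpi u) = rbpi (RBadd t u).
Proof. by apply: rbpiW; apply: rbeq_add; apply: repr_rbpi. Qed.

Lemma rbpi_opp t : freeRB_opp (rbpi t) = rbpi (RBscale (- 1) t).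
Proof. by apply: rbpiW; apply: rbeq_scale; apply: repr_rbpi. Qed.

Lemma rbpi_scale a t : freeRB_scale a (rbpi t) = rbpi (RBscale a t).
Proof. by apply: rbpiW; apply: rbeq_scale; apply: repr_rbpi. Qed.

Lemma rbpi_mul t u : freeRB_mul (rbpi t) (rbpi u) = rbpi (RBmul t u).
Proof. by apply: rbpiW; apply: rbeq_mul; apply: repr_rbpi. Qed.

Lemma rbpi_op t : freeRB_op (rbpi t) = rbpi (RBop t).
Proof. by apply: rbpiW; apply: rbeq_op; apply: repr_rbpi. Qed.

Definition rbpiE := (rbpi_add, rbpi_opp, rbpi_scale, rbpi_mul, rbpi_op).

Fact freeRB_addA : associative freeRB_add.
Proof.
elim/rbpi_ind=> t; elim/rbpi_ind=> u; elim/rbpi_ind=> v.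
by rewrite !rbpiE; apply/rbpiW/rbeq_addA.
Qed.

Fact freeRB_addC : commutative freeRB_add.
Proof.
elim/rbpi_ind=> t; elim/rbpi_ind=> u.
by rewrite !rbpiE; apply/rbpiW/rbeq_addC.
Qed.

Fact freeRB_add0 : left_id (rbpi RBzero) freeRB_add.
Proof. by elim/rbpi_ind=> t; rewrite !rbpiE; apply/rbpiW/rbeq_add0. Qed.

Fact freeRB_addN : left_inverse (rbpi RBzero) freeRB_opp freeRB_add.
Proof. by elim/rbpi_ind=> t; rewrite !rbpiE; apply/rbpiW/rbeq_addN. Qed.

HB.instance Definition _ := GRing.isZmodule.Build freeRB
  freeRB_addA freeRB_addC freeRB_add0 freeRB_addN.

Fact freeRB_scaleA a b (x : freeRB) :
  freeRB_scale a (freeRB_scale b x) = freeRB_scale (a * b) x.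
Proof. by elim/rbpi_ind: x => t; rewrite !rbpiE; apply/rbpiW/rbeq_scaleA. Qed.

Fact freeRB_scale1 : left_id 1 freeRB_scale.
Proof. by elim/rbpi_ind=> t; rewrite !rbpiE; apply/rbpiW/rbeq_scale1. Qed.

Fact freeRB_scaleDr : right_distributive freeRB_scale +%R.
Proof.
move=> a; elim/rbpi_ind=> t; elim/rbpi_ind=> u.
by rewrite /GRing.add /= !rbpiE; apply/rbpiW/rbeq_scaleDr.
Qed.

Fact freeRB_scaleDl (x : freeRB) :
  {morph freeRB_scale^~ x : a b / a + b >-> a + b}.
Proof.
move=> a b /=; elim/rbpi_ind: x => t.
rewrite [X in _ = X]/GRing.add /= !rbpiE; exact/rbpiW/rbeq_scaleDl.
Qed.

HB.instance Definition _ := GRing.Zmodule_isLmodule.Build F freeRB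
  freeRB_scaleA freeRB_scale1 freeRB_scaleDr freeRB_scaleDl.

Lemma rbpiD t u : rbpi (RBadd t u) = rbpi t + rbpi u.
Proof. by rewrite -rbpi_add. Qed.

Lemma rbpiZ a t : rbpi (RBscale a t) = a *: rbpi t.
Proof. by rewrite -rbpi_scale. Qed.

Fact freeRB_mul_linearl y : linear (freeRB_mul^~ y).
Proof.
move=> a u v; elim/rbpi_ind: y => y; elim/rbpi_ind: u => u.
elim/rbpi_ind: v => v; rewrite -rbpiZ -rbpiD !rbpi_mul -rbpiZ -rbpiD.
apply/rbpiW/(rbeq_trans (rbeq_mulDl _ _ _))/rbeq_add; last exact: rbeq_refl.
exact: rbeq_mulZl.
Qed.

Fact freeRB_mul_linearr x : linear (freeRB_mul x).
Proof.
move=> a u v; elim/rbpi_ind: x => x; elim/rbpi_ind: u => u.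
elim/rbpi_ind: v => v; rewrite -rbpiZ -rbpiD !rbpi_mul -rbpiZ -rbpiD.
apply/rbpiW/(rbeq_trans (rbeq_mulDr _ _ _))/rbeq_add; last exact: rbeq_refl.
exact: rbeq_mulZr.
Qed.

Fact freeRB_mulA : associative freeRB_mul.
Proof.
elim/rbpi_ind=> t; elim/rbpi_ind=> u; elim/rbpi_ind=> v.
by rewrite !rbpiE; apply/rbpiW/rbeq_mulA.
Qed.

HB.instance Definition _ := isNonUnitalAlgebra.Build F freeRB
  freeRB_mul_linearl freeRB_mul_linearr freeRB_mulA.

Fact freeRB_op_linear : linear freeRB_op.
Proof.
move=> a; elim/rbpi_ind=> u; elim/rbpi_ind=> v.
rewrite -rbpiZ -rbpiD !rbpi_op -rbpiZ -rbpiD.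
apply/rbpiW/(rbeq_trans (rbeq_opD _ _))/rbeq_add; last exact: rbeq_refl.
exact: rbeq_opZ.
Qed.

Fact freeRB_opM (x y : freeRB) :
  freeRB_op x ⋆ freeRB_op y =
  freeRB_op (freeRB_op x ⋆ y) + freeRB_op (x ⋆ freeRB_op y).
Proof.
elim/rbpi_ind: x => t; elim/rbpi_ind: y => u.
by rewrite /numul /= !rbpiE -rbpiD; apply/rbpiW/rbeq_opM.
Qed.

HB.instance Definition _ := isRotaBaxter.Build F freeRB
  freeRB_op_linear freeRB_opM.

Lemma rbpi0 : rbpi RBzero = 0. Proof. by []. Qed.

Lemma rbpiM t u : rbpi (RBmul t u) = rbpi t ⋆ rbpi u.
Proof. by rewrite -rbpi_mul. Qed.

Lemma rbpiP_op t : rbpi (RBop t) = rbP (rbpi t).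
Proof. by rewrite -rbpi_op. Qed.

End FreeRB.

Section FreeRBUniversal.
Variables (F : fieldType) (X : Type) (A : rotaBaxterType F) (g : X -> A).

Fixpoint rbeval (t : rbterm F X) : A :=
  match t with
  | RBgen i => g i
  | RBzero => 0
  | RBadd t u => rbeval t + rbeval u
  | RBscale a t => a *: rbeval t
  | RBmul t u => rbeval t ⋆ rbeval u
  | RBop t => rbP (rbeval t)
  end.

Lemma rbeval_rbeq t u : rbeq t u -> rbeval t = rbeval u.
Proof.
elim=> //=.
- by move=> ? ? ? _ -> _ ->.
- by move=> ? ? ? ? _ -> _ ->.
- by move=> ? ? ? _ ->.
- by move=> ? ? ? ? _ -> _ ->.
- by move=> ? ? _ ->.
- by move=> *; rewrite addrA.
- by move=> *; rewrite addrC.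
- by move=> *; rewrite add0r.
- by move=> *; rewrite scaleN1r addNr.
- by move=> *; rewrite scalerA.
- by move=> *; rewrite scale1r.
- by move=> *; rewrite scalerDr.
- by move=> *; rewrite scalerDl.
- by move=> *; rewrite numulDl.
- by move=> *; rewrite numulDr.
- by move=> *; rewrite numulZl.
- by move=> *; rewrite numulZr.
- by move=> *; rewrite numulA.
- by move=> *; rewrite linearD.
- by move=> *; rewrite linearZ.
- by move=> *; rewrite rbPM.
Qed.

Definition freeRB_lift (x : freeRB F X) : A := rbeval (repr x).

Lemma freeRB_liftE t : freeRB_lift (rbpi t) = rbeval t.
Proof. exact/rbeval_rbeq/repr_rbpi. Qed.

Lemma freeRB_lift_gen i : freeRB_lift (freeRB_gen F i) = g i.
Proof. by rewrite freeRB_liftE. Qed.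

Lemma freeRB_lift_morphism : rb_morphism freeRB_lift.
Proof.
split=> [a||].
- elim/rbpi_ind=> t; elim/rbpi_ind=> u.
  by rewrite -rbpiZ -rbpiD !freeRB_liftE.
- by elim/rbpi_ind=> t; elim/rbpi_ind=> u; rewrite -rbpiM !freeRB_liftE.
- by elim/rbpi_ind=> t; rewrite -rbpiP_op !freeRB_liftE.
Qed.

Lemma freeRB_lift_unique (f : freeRB F X -> A) : rb_morphism f ->
  (forall i, f (freeRB_gen F i) = g i) -> f =1 freeRB_lift.
Proof.
move=> [fL fM fP] fg; elim/rbpi_ind=> t; rewrite freeRB_liftE.
have fD x y : f (x + y) = f x + f y.
  by have := fL 1 x y; rewrite !scale1r.
have f0 : f 0 = 0 by apply: (@addrI _ (f 0)); rewrite -fD !addr0.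
have fZ a x : f (a *: x) = a *: f x by have := fL a x 0; rewrite f0 !addr0.
elim: t => [i||t IHt u IHu|a t IHt|t IHt u IHu|t IHt] /=.
- exact: fg.
- exact: f0.
- by rewrite rbpiD fD IHt IHu.
- by rewrite rbpiZ fZ IHt.
- by rewrite rbpiM fM IHt IHu.
- by rewrite rbpiP_op fP IHt.
Qed.

End FreeRBUniversal.

Definition rb_ideal (F : fieldType) (A : rotaBaxterType F) (J : set A) : Prop :=
  [/\ J 0,
      forall a x y, J x -> J y -> J (a *: x + y),
      forall x y, J x -> J (x ⋆ y),
      forall x y, J y -> J (x ⋆ y) &
      forall x, J x -> J (rbP x)].

Definition rb_Id (F : fieldType) (A : rotaBaxterType F) (R : set A) : set A :=
  smallest (@rb_ideal F A) R.

Section RBQuotient.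
Variables (F : fieldType) (A : rotaBaxterType F) (R : set A).

Lemma rb_Id_ideal : rb_ideal (rb_Id R).
Proof.
split=> [J [[]]//|a x y Jx Jy J KJ|x y Jx J KJ|x y Jy J KJ|x Jx J KJ].
- by case: (KJ) => -[_ + _ _ _] _; apply; [apply: Jx|apply: Jy].
- by case: (KJ) => -[_ _ + _ _] _; apply; apply: Jx.
- by case: (KJ) => -[_ _ _ + _] _; apply; apply: Jy.
- by case: (KJ) => -[_ _ _ _ +] _; apply; apply: Jx.
Qed.

Lemma sub_rb_Id : R `<=` rb_Id R.
Proof. exact: sub_gen_smallest. Qed.

Lemma rb_Id_min (J : set A) : rb_ideal J -> R `<=` J -> rb_Id R `<=` J.
Proof. exact: smallest_sub. Qed.

Definition rb_Idb : {pred A} := fun x => `[< rb_Id R x >].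

Fact rb_Idb_zmod_closed : zmod_closed rb_Idb.
Proof.
have [J0 JL _ _ _] := rb_Id_ideal; split=> [|x y]; first exact/asboolP.
move=> /asboolP Jx /asboolP Jy; apply/asboolP.
by rewrite addrC -scaleN1r; apply: JL.
Qed.

HB.instance Definition _ := GRing.isZmodClosed.Build A rb_Idb
  rb_Idb_zmod_closed.

Definition rb_quot : Type := Quotient.quot rb_Idb.

HB.instance Definition _ := GRing.Zmodule.on rb_quot.

Definition rb_class (x : A) : rb_quot := \pi_(Quotient.quot rb_Idb) x.

Lemma rb_classP x y : rb_class x = rb_class y <-> rb_Id R (x - y).
Proof.
split=> [/eqP|xy]; first by rewrite -Quotient.idealrBE => /asboolP.
by apply/eqP; rewrite -Quotient.idealrBE; apply/asboolP.
Qed.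

Lemma rb_class_ind (Q : rb_quot -> Prop) :
  (forall x, Q (rb_class x)) -> forall x, Q x.
Proof. by move=> Qpi x; rewrite -[x]reprK; apply: Qpi. Qed.

Lemma rb_Id_repr x : rb_Id R (repr (rb_class x) - x).
Proof. by apply/rb_classP; rewrite {1}/rb_class reprK. Qed.

Lemma rb_classD x y : rb_class (x + y) = rb_class x + rb_class y.
Proof. by rewrite /rb_class raddfD. Qed.

Definition rb_quot_scale (a : F) (x : rb_quot) := rb_class (a *: repr x).
Definition rb_quot_mul (x y : rb_quot) := rb_class (repr x ⋆ repr y).
Definition rb_quot_op (x : rb_quot) := rb_class (rbP (repr x)).

Lemma rb_quot_scaleE a x : rb_quot_scale a (rb_class x) = rb_class (a *: x).
Proof.
have [J0 JL _ _ _] := rb_Id_ideal.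
apply/rb_classP; rewrite -scalerBr -[_ *: _]addr0; apply: JL => //.
exact: rb_Id_repr.
Qed.

Lemma rb_quot_mulE x y :
  rb_quot_mul (rb_class x) (rb_class y) = rb_class (x ⋆ y).
Proof.
have [J0 JL JMl JMr _] := rb_Id_ideal.
apply/rb_classP; rewrite -(subrKA (x ⋆ repr (rb_class y))) -numulBl -numulBr.
rewrite -[X in X + _]scale1r.
by apply: JL; [apply: JMl|apply: JMr]; apply: rb_Id_repr.
Qed.

Lemma rb_quot_opE x : rb_quot_op (rb_class x) = rb_class (rbP x).
Proof.
have [_ _ _ _ JP] := rb_Id_ideal.
by apply/rb_classP; rewrite -linearB; apply: JP; apply: rb_Id_repr.
Qed.

Fact rb_quot_scaleA a b (x : rb_quot) :
  rb_quot_scale a (rb_quot_scale b x) = rb_quot_scale (a * b) x.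
Proof.
by elim/rb_class_ind: x => x; rewrite !rb_quot_scaleE scalerA.
Qed.

Fact rb_quot_scale1 : left_id 1 rb_quot_scale.
Proof. by elim/rb_class_ind=> x; rewrite rb_quot_scaleE scale1r. Qed.

Fact rb_quot_scaleDr : right_distributive rb_quot_scale +%R.
Proof.
move=> a; elim/rb_class_ind=> x; elim/rb_class_ind=> y.
by rewrite -rb_classD !rb_quot_scaleE scalerDr rb_classD.
Qed.

Fact rb_quot_scaleDl (x : rb_quot) :
  {morph rb_quot_scale^~ x : a b / a + b >-> a + b}.
Proof.
move=> a b /=; elim/rb_class_ind: x => x.
by rewrite !rb_quot_scaleE scalerDl rb_classD.
Qed.

HB.instance Definition _ := GRing.Zmodule_isLmodule.Build F rb_quot
  rb_quot_scaleA rb_quot_scale1 rb_quot_scaleDr rb_quot_scaleDl.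

Lemma rb_classZ a x : rb_class (a *: x) = a *: rb_class x.
Proof. by rewrite -rb_quot_scaleE. Qed.

Fact rb_class_linear : linear rb_class.
Proof. by move=> a x y; rewrite rb_classD rb_classZ. Qed.

Fact rb_quot_mul_linearl y : linear (rb_quot_mul^~ y).
Proof.
elim/rb_class_ind: y => y a; elim/rb_class_ind=> u; elim/rb_class_ind=> v.
by rewrite -rb_class_linear !rb_quot_mulE numul_linearl rb_class_linear.
Qed.

Fact rb_quot_mul_linearr x : linear (rb_quot_mul x).
Proof.
elim/rb_class_ind: x => x a; elim/rb_class_ind=> u; elim/rb_class_ind=> v.
by rewrite -rb_class_linear !rb_quot_mulE numul_linearr rb_class_linear.
Qed.

Fact rb_quot_mulA : associative rb_quot_mul.
Proof.
elim/rb_class_ind=> x; elim/rb_class_ind=> y; elim/rb_class_ind=> z.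
by rewrite !rb_quot_mulE numulA.
Qed.

HB.instance Definition _ := isNonUnitalAlgebra.Build F rb_quot
  rb_quot_mul_linearl rb_quot_mul_linearr rb_quot_mulA.

Fact rb_quot_op_linear : linear rb_quot_op.
Proof.
move=> a; elim/rb_class_ind=> u; elim/rb_class_ind=> v.
by rewrite -rb_class_linear !rb_quot_opE linearP rb_class_linear.
Qed.

Fact rb_quot_opM (x y : rb_quot) :
  rb_quot_op x ⋆ rb_quot_op y =
  rb_quot_op (rb_quot_op x ⋆ y) + rb_quot_op (x ⋆ rb_quot_op y).
Proof.
elim/rb_class_ind: x => x; elim/rb_class_ind: y => y.
by rewrite /numul /= !(rb_quot_mulE, rb_quot_opE) -rb_classD rbPM.
Qed.

HB.instance Definition _ := isRotaBaxter.Build F rb_quot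
  rb_quot_op_linear rb_quot_opM.

Lemma rb_class_morphism : rb_morphism rb_class.
Proof.
split; first exact: rb_class_linear.
  by move=> x y; rewrite -rb_quot_mulE.
by move=> x; rewrite -rb_quot_opE.
Qed.

End RBQuotient.

HB.instance Definition _ (F : fieldType) (A : rotaBaxterType F) (R : set A) :=
  GRing.isLinear.Build F A (rb_quot R) *:%R (@rb_class F A R)
    (@rb_class_linear F A R).

Definition lin_basis (F : fieldType) (V : lmodType F) (I : choiceType)
    (b : I -> V) : Prop :=
  (forall (s : seq I) (c : I -> F), uniq s ->
     \sum_(i <- s) c i *: b i = 0 -> {in s, forall i, c i = 0}) /\
  (forall v : V, exists (s : seq I) (c : I -> F),
     uniq s /\ v = \sum_(i <- s) c i *: b i).

Section LinExt.
Variables (F : fieldType) (V W : lmodType F) (I : choiceType).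
Variables (b : I -> V) (hb : lin_basis b) (g : I -> W).

Definition basis_supp (v : V) : seq I := projT1 (cid (hb.2 v)).
Definition basis_coord (v : V) : I -> F := projT1 (cid (projT2 (cid (hb.2 v)))).

Lemma basis_supp_uniq v : uniq (basis_supp v).
Proof. exact: (projT2 (cid (projT2 (cid (hb.2 v))))).1. Qed.

Lemma basis_coordE v :
  v = \sum_(i <- basis_supp v) basis_coord v i *: b i.
Proof. exact: (projT2 (cid (projT2 (cid (hb.2 v))))).2. Qed.

Definition lin_ext (v : V) : W :=
  \sum_(i <- basis_supp v) basis_coord v i *: g i.

Let pad (s : seq I) (c : I -> F) i := if i \in s then c i else 0.

Let sum_pad (U : lmodType F) (h : I -> U) (s t : seq I) (c : I -> F) :
  uniq s -> uniq t -> {subset s <= t} ->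
  \sum_(i <- s) c i *: h i = \sum_(i <- t) pad s c i *: h i.
Proof.
move=> us ut st; have st' : perm_eq s [seq i <- t | i \in s].
  apply: uniq_perm => //; first exact: filter_uniq.
  by move=> i; rewrite mem_filter; case: (boolP (i \in s)) => [/st ->|_].
rewrite (perm_big _ st') big_filter /= big_mkcond /=; apply: eq_bigr => i _.
by rewrite /pad; case: ifP => // _; rewrite scale0r.
Qed.

Fact lin_ext_linear : linear lin_ext.
Proof.
move=> a u v; set w := a *: u + v.
pose t := undup (basis_supp u ++ basis_supp v ++ basis_supp w).
have ut : uniq t by exact: undup_uniq.
have su : {subset basis_supp u <= t}.
  by move=> i iu; rewrite mem_undup !mem_cat iu.
have sv : {subset basis_supp v <= t}.
  by move=> i iu; rewrite mem_undup !mem_cat iu orbT.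
have sw : {subset basis_supp w <= t}.
  by move=> i iu; rewrite mem_undup !mem_cat iu !orbT.
pose P x := pad (basis_supp x) (basis_coord x).
have E (U : lmodType F) (h : I -> U) x : {subset basis_supp x <= t} ->
    \sum_(i <- basis_supp x) basis_coord x i *: h i = \sum_(i <- t) P x i *: h i.
  by move=> xt; apply: sum_pad => //; apply: basis_supp_uniq.
have h0 : \sum_(i <- t) (P w i - (a * P u i + P v i)) *: b i = 0.
  under eq_bigr do rewrite scalerBl scalerDl -scalerA.
  by rewrite sumrB big_split -scaler_sumr /= -!E // -!basis_coordE subrr.
have {}h0 := hb.1 t _ ut h0.
rewrite /lin_ext !E // scaler_sumr -big_split /= big_seq [RHS]big_seq.
apply: eq_bigr => i it; rewrite scalerA -scalerDl; congr (_ *: _).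
by apply/eqP; rewrite -subr_eq0 (h0 i it).
Qed.

HB.instance Definition _ := GRing.isLinear.Build F V W *:%R lin_ext
  lin_ext_linear.

Lemma lin_ext_basis i : lin_ext (b i) = g i.
Proof.
pose t := undup (i :: basis_supp (b i)).
have ut : uniq t by exact: undup_uniq.
have it : {subset [:: i] <= t}.
  by move=> j; rewrite inE => /eqP ->; rewrite mem_undup inE eqxx.
have st : {subset basis_supp (b i) <= t}.
  by move=> j; rewrite mem_undup inE orbC => ->.
have us := basis_supp_uniq (b i).
pose c j := pad [:: i] (fun=> 1) j - pad (basis_supp (b i)) (basis_coord (b i)) j.
have h0 : \sum_(j <- t) c j *: b j = 0.
  under eq_bigr do rewrite scalerBl.
  by rewrite sumrB -!sum_pad // -basis_coordE big_seq1 scale1r subrr.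
have {}h0 := hb.1 t c ut h0.
rewrite /lin_ext (sum_pad _ _ us ut st) -[g i]scale1r.
rewrite -(big_seq1 +%R i (fun j => (fun=> 1) j *: g j)).
rewrite (@sum_pad _ _ [:: i] t) // big_seq [RHS]big_seq.
apply: eq_bigr => j jt; congr (_ *: _).
by apply/esym/eqP; rewrite -subr_eq0; apply/eqP; exact: (h0 j jt).
Qed.

End LinExt.

Section Enveloping.
Variables (F : fieldType) (D : dendriformType F) (I : choiceType).
Variables (b : I -> D) (hb : lin_basis b).

Local Notation X := (@freeRB_gen F I).

(* The element {v} of RB(X): v expanded in the basis, read in RB(X). *)
Definition expand : D -> freeRB F I := lin_ext hb X.

Definition env_rel : set (freeRB F I) :=
  [set r | exists i j : I,
     r = X i ⋆ rbP (X j) - expand (b i ≺ b j) \/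
     r = rbP (X i) ⋆ X j - expand (b i ≻ b j)].

Definition envRB : Type := rb_quot env_rel.

HB.instance Definition _ := RotaBaxter.on envRB.

Definition env_map : D -> envRB :=
  lin_ext hb (fun i => rb_class env_rel (X i)).

HB.instance Definition _ := GRing.isLinear.Build F D (freeRB F I) *:%R expand
  (lin_ext_linear hb X).

HB.instance Definition _ := GRing.isLinear.Build F D envRB *:%R env_map
  (lin_ext_linear hb (fun i => rb_class env_rel (X i))).

Lemma expand_basis i : expand (b i) = X i.
Proof. exact: lin_ext_basis. Qed.

Lemma env_map_basis i : env_map (b i) = rb_class env_rel (X i).
Proof. exact: lin_ext_basis. Qed.

End Enveloping.

(* Main.v *)
Require Import Defs.
From HB Require Import structures.
From mathcomp Require Import all_boot all_order all_algebra.
From mathcomp Require Import boolp classical_sets.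

Set Implicit Arguments.
Unset Strict Implicit.

Import GRing.Theory.
Local Open Scope ring_scope.

(** Every dendriform algebra [D] sits inside an explicit Rota-Baxter algebra of
    weight 0, and this forces the universal one to contain it.

    The sum x * y = x ≺ y + x ≻ y is an associative product on [D], and the
    three dendriform identities say that ≻ and ≺ are a left and a right action
    making [D] a bimodule over the associative algebra (D, * ).  Hence the
    split extension D ⊕ D' of (D, * ) by a copy D' of this bimodule, with
    D' D' = 0, is associative.  Let P send x' to x and vanish on the first
    summand.  Then P(x') y' = (x ≻ y)' and x' P(y') = (x ≺ y)', so
    x |-> x' is an injective dendriform morphism; the Rota-Baxter identity for
    x' and y' is the definition of *, and for the other pairs both sides vanish
    because P kills the subalgebra D.

    By freeness, b i |-> (b i)' induces a Rota-Baxter morphism from RB(X) to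
    D ⊕ D'.  It kills the defining relations of U(D), hence the ideal they
    generate, and composed with the expansion in the basis it is x |-> x'.  So
    x |-> x' factors through D -> U(D), which is therefore injective. *)

(** * The split extension of a dendriform algebra *)

Lemma linear_fun0 (F : fieldType) (V W : lmodType F) (f : V -> W) :
  linear f -> f 0 = 0.
Proof. by move=> /(_ (- 1) 0 0); rewrite scaler0 addr0 scaleN1r addNr. Qed.

Section DendriformTheory.
Variables (F : fieldType) (D : dendriformType F).
Implicit Types x y z : D.

Lemma dprecDl x y z : (x + y) ≺ z = x ≺ z + y ≺ z.
Proof. by have := dprec_linearl z 1 x y; rewrite !scale1r. Qed.

Lemma dsuccDr x y z : x ≻ (y + z) = x ≻ y + x ≻ z.
Proof. by have := dsucc_linearr x 1 y z; rewrite !scale1r. Qed.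

Lemma dprec0l x : 0 ≺ x = 0.
Proof. exact: linear_fun0 (dprec_linearl x). Qed.

Lemma dprecr0 x : x ≺ 0 = 0.
Proof. exact: linear_fun0 (dprec_linearr x). Qed.

Lemma dsucc0l x : 0 ≻ x = 0.
Proof. exact: linear_fun0 (dsucc_linearl x). Qed.

Lemma dsuccr0 x : x ≻ 0 = 0.
Proof. exact: linear_fun0 (dsucc_linearr x). Qed.

Definition dmul x y : D := x ≺ y + x ≻ y.

Lemma dmul_linearl y : linear (dmul^~ y).
Proof.
by move=> a u v; rewrite /dmul dprec_linearl dsucc_linearl scalerDr addrACA.
Qed.

Lemma dmul_linearr x : linear (dmul x).
Proof.
by move=> a u v; rewrite /dmul dprec_linearr dsucc_linearr scalerDr addrACA.
Qed.

(** The sum of the three dendriform identities. *)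
Lemma dmulA : associative dmul.
Proof.
move=> x y z; rewrite [dmul (dmul x y) z]/dmul /dmul dsuccA dprecDl dprecA.
by rewrite dsucc_precA dsuccDr addrA.
Qed.

End DendriformTheory.

(** D ⊕ D': the first component lies in the associative algebra (D, * ), the
    second in the bimodule D'. *)
Definition split_ext (F : fieldType) (D : dendriformType F) : Type :=
  (D * D)%type.

HB.instance Definition _ (F : fieldType) (D : dendriformType F) :=
  GRing.Lmodule.copy (split_ext D) (D * D)%type.

Section SplitExtension.
Variables (F : fieldType) (D : dendriformType F).
Local Notation E := (split_ext D).
Implicit Types p q r : E.

Definition split_mul p q : E := (dmul p.1 q.1, p.1 ≻ q.2 + p.2 ≺ q.1).

Definition split_op p : E := (p.2, 0).

Lemma split_mul_linearl q : linear (split_mul^~ q).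
Proof.
move=> a u v; congr pair => /=; first exact: dmul_linearl.
by rewrite dsucc_linearl dprec_linearl scalerDr addrACA.
Qed.

Lemma split_mul_linearr p : linear (split_mul p).
Proof.
move=> a u v; congr pair => /=; first exact: dmul_linearr.
by rewrite dsucc_linearr dprec_linearr scalerDr addrACA.
Qed.

(** On the second components this is the bimodule property of D', whose three
    axioms are the three dendriform identities. *)
Lemma split_mulA : associative split_mul.
Proof.
move=> p q r; congr pair => /=; first exact: dmulA.
by rewrite /dmul dsuccDr dprecDl dsuccA dsucc_precA dprecA addrA.
Qed.

HB.instance Definition _ := isNonUnitalAlgebra.Build F E
  split_mul_linearl split_mul_linearr split_mulA.

Lemma split_op_linear : linear split_op.
Proof. by move=> a u v; congr pair => /=; rewrite scaler0 addr0. Qed.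

Lemma split_opM p q :
  split_op p ⋆ split_op q =
  split_op (split_op p ⋆ q) + split_op (p ⋆ split_op q).
Proof.
congr pair => /=; last by rewrite dprec0l dsuccr0.
by rewrite dprec0l dsuccr0 addr0 add0r addrC.
Qed.

HB.instance Definition _ := isRotaBaxter.Build F E split_op_linear split_opM.

Definition split_in (x : D) : rb_dendriform E := (0, x).

Lemma split_in_morphism : dendriform_morphism split_in.
Proof.
split=> [a u v|x y|x y]; apply: (congr2 pair) => //=.
- by rewrite scaler0 addr0.
- by rewrite /dmul dprec0l dsucc0l addr0.
- by rewrite dsucc0l add0r.
- by rewrite /dmul dprecr0 dsuccr0 addr0.
- by rewrite dprec0l addr0.
Qed.

Lemma split_in_inj : injective split_in.
Proof. by move=> x y []. Qed.

End SplitExtension.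

(** * The universal enveloping Rota-Baxter algebra *)

Lemma lin_basis_eq (F : fieldType) (V W : lmodType F) (I : choiceType)
    (b : I -> V) (f g : V -> W) : lin_basis b -> linear f -> linear g ->
  (forall i, f (b i) = g (b i)) -> f =1 g.
Proof.
move=> [_ span_b] fL gL fg v; have [s [c [_ ->]]] := span_b v.
elim: s => [|i s IHs]; first by rewrite big_nil !linear_fun0.
by rewrite big_cons fL gL fg IHs.
Qed.

Lemma lin_basis_eq2 (F : fieldType) (V W : lmodType F) (I : choiceType)
    (b : I -> V) (f g : V -> V -> W) : lin_basis b ->
  (forall y, linear (f^~ y)) -> (forall x, linear (f x)) ->
  (forall y, linear (g^~ y)) -> (forall x, linear (g x)) ->
  (forall i j, f (b i) (b j) = g (b i) (b j)) -> f =2 g.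
Proof.
move=> hb fl fr gl gr fg x y.
apply: (lin_basis_eq hb (fl y) (gl y)) => i.
exact: (lin_basis_eq hb (fr (b i)) (gr (b i))).
Qed.

Section Enveloping.
Variables (F : fieldType) (D : dendriformType F) (I : choiceType).
Variables (b : I -> D) (hb : lin_basis b).

Local Notation X := (@freeRB_gen F I).

Lemma env_mapE x : env_map hb x = rb_class (env_rel hb) (expand hb x).
Proof.
rewrite /env_map /expand /lin_ext linear_sum.
by apply: eq_bigr => i _; rewrite linearZ.
Qed.

(** Both sides of each identity are bilinear, and on basis elements they agree
    by the defining relations of the enveloping algebra. *)
Lemma env_map_morphism :
  dendriform_morphism (env_map hb : D -> rb_dendriform (envRB hb)).
Proof.
have [_ classM classP] := rb_class_morphism (env_rel hb).
split; first exact: linearP.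
- apply: (lin_basis_eq2 hb) => [y a u v|x a u v|y a u v|x a u v|i j].
  + by rewrite dprec_linearl linearP.
  + by rewrite dprec_linearr linearP.
  + by rewrite linearP dprec_linearl.
  + by rewrite linearP dprec_linearr.
  rewrite [LHS]env_mapE !env_map_basis; apply/esym.
  rewrite /dprec /= -classP -classM; apply/rb_classP.
  by apply: sub_rb_Id; exists i, j; left.
- apply: (lin_basis_eq2 hb) => [y a u v|x a u v|y a u v|x a u v|i j].
  + by rewrite dsucc_linearl linearP.
  + by rewrite dsucc_linearr linearP.
  + by rewrite linearP dsucc_linearl.
  + by rewrite linearP dsucc_linearr.
  rewrite [LHS]env_mapE !env_map_basis; apply/esym.
  rewrite /dsucc /= -classP -classM; apply/rb_classP.
  by apply: sub_rb_Id; exists i, j; right.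
Qed.

End Enveloping.

Lemma rb_morphism_ker (F : fieldType) (A B : rotaBaxterType F) (f : A -> B) :
  rb_morphism f -> rb_ideal [set x | f x = 0].
Proof.
move=> [fL fM fP]; have f0 := linear_fun0 fL.
split=> [|a x y|x y|x y|x] //=.
- by move=> fx0 fy0; rewrite fL fx0 fy0 scaler0 addr0.
- by move=> fx0; rewrite fM fx0 numul0r.
- by move=> fy0; rewrite fM fy0 numulr0.
- by move=> fx0; rewrite fP fx0 linear0.
Qed.

(** The morphism that [f \o b] induces on the free Rota-Baxter algebra kills the
    defining relations, because [f] respects both products; its kernel is a
    Rota-Baxter ideal, so it contains the ideal they generate.  Hence [f]
    factors through the enveloping algebra. *)
Lemma env_map_factor (F : fieldType) (D : dendriformType F) (I : choiceType)
    (b : I -> D) (hb : lin_basis b) (A : rotaBaxterType F)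
    (f : D -> rb_dendriform A) : dendriform_morphism f ->
  forall x y, env_map hb x = env_map hb y -> f x = f y.
Proof.
move=> [fL fprec fsucc] x y.
pose phi : freeRB F I -> A := freeRB_lift (f \o b).
have phiRB : rb_morphism phi := freeRB_lift_morphism (f \o b).
have [phiL phiM phiP] := phiRB.
have phiX i : phi (freeRB_gen F i) = f (b i) by exact: freeRB_lift_gen.
have phi_expand v : phi (expand hb v) = f v.
  apply: (lin_basis_eq (f := phi \o expand hb) hb) => [a u w| |i] //=.
    by rewrite linearP phiL.
  by rewrite expand_basis phiX.
have phiB u v : phi (u - v) = phi u - phi v.
  by rewrite addrC -scaleN1r phiL scaleN1r addrC.
have phi_rel : (env_rel hb `<=` [set r | phi r = 0])%classic.
  move=> r [i [j [|]]] -> /=.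
  - by rewrite phiB phi_expand phiM phiP !phiX fprec subrr.
  - by rewrite phiB phi_expand phiM phiP !phiX fsucc subrr.
rewrite !env_mapE => /rb_classP /(rb_Id_min (rb_morphism_ker phiRB) phi_rel).
by rewrite /= phiB !phi_expand => /eqP; rewrite subr_eq0 => /eqP.
Qed.

Theorem theorem1p1 (F : fieldType) (charF0 : [pchar F] =i pred0)
    (D : dendriformType F) :
  (forall (I : choiceType) (b : I -> D) (hb : lin_basis b),
     dendriform_morphism (env_map hb : D -> rb_dendriform (envRB hb)) /\
     injective (env_map hb)) /\
  (exists (A : rotaBaxterType F) (f : D -> rb_dendriform A),
     dendriform_morphism f /\ injective f).
Proof.
have split_morph := @split_in_morphism F D.
split=> [I b hb|].
  split; first exact: env_map_morphism.
  by move=> x y /(env_map_factor split_morph)/split_in_inj.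
by exists (split_ext D), (@split_in F D); split; last exact: split_in_inj.
Qed.
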